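(* Let $n\ge 1$, $a,b\in\mathbb{R}^n$ and let $Q\in\mathbb{R}^{n\times n}$ be symmetric positive semidefinite. Consider the problem (OptPairs) $$\begin{aligned}\min_{x,y,Y}\ & a'x+b'y+\langle Q,Y\rangle\\ \text{s.t. } & Y-yy'\succeq 0,\\ & (x_i,x_j,y_i,y_j,Y_{ii},Y_{ij},Y_{jj})\in\mathcal W\qquad\text{for all }1\le i<j\le n,\\ & 0\le x\le 1,\ y\ge 0,\end{aligned}$$ over $x,y\in\mathbb{R}^n$ and symmetric $Y\in\mathbb{R}^{n\times n}$, with $\mathcal W$ as defined in the context. Then (OptPairs) is a valid convex relaxation of $$(\mathrm{QI})\qquad \min\{a'x+b'y+y'Qy:(x,y)\in\mathcal I_n\},$$ and every feasible solution $(x,y,Y)$ of (OptPairs) satisfies, for every pair $i<j$, both inequalities $$\max_{d\in\mathcal D}\left\{f_+^*(x_i,x_j,y_i,y_j;d_1,d_2)-d_1Y_{ii}-d_2Y_{jj}-2Y_{ij}\right\}\le 0,$$ $$\max_{d\in\mathcal D}\left\{f_-^*(x_i,x_j,y_i,y_j;d_1,d_2)-d_1Y_{ii}-d_2Y_{jj}+2Y_{ij}\right\}\le 0.$$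
   Context: A prime denotes transpose, $\langle Q,Y\rangle=\sum_{i,j}Q_{ij}Y_{ij}$, and $A\succeq 0$ means symmetric positive semidefinite. $\mathcal I_n=\{(x,y)\in\{0,1\}^n\times\mathbb{R}^n_+: y_i(1-x_i)=0,\ i=1,\dots,n\}$. ''Valid convex relaxation of (QI)'' means: the feasible set of (OptPairs) is convex (its objective is linear), and for every $(x,y)\in\mathcal I_n$ the point $(x,y,yy')$ is feasible for (OptPairs) (and has objective value $a'x+b'y+y'Qy$). $\mathcal W$ is the set of points $(x_1,x_2,y_1,y_2,Y_{11},Y_{12},Y_{22})$ for which there exists a symmetric $3\times3$ matrix $W\succeq 0$ with - $W_{12}=Y_{12}$; - $(Y_{11}-W_{11})(x_1-W_{33})\ge(y_1-W_{31})^2$, $W_{11}\le Y_{11}$, $W_{33}\le x_1$; - $(Y_{22}-W_{22})(x_2-W_{33})\ge(y_2-W_{32})^2$, $W_{22}\le Y_{22}$, $W_{33}\le x_2$; - $0\le W_{31}\le y_1$, $0\le W_{32}\le y_2$; - $W_{33}\ge x_1+x_2-1$. $\mathcal D=\{d\in\mathbb{R}^2:d_1\ge0,\ d_2\ge 0,\ d_1d_2\ge1\}$. For $x\in[0,1]^2$, $y\in\mathbb{R}^2_+$, $d\in\mathcal D$, $$f_+^*(x,y;d)=\min_{z,\lambda}\left\{\tfrac{d_1(y_1-z_1)^2}{x_1-\lambda}+\tfrac{d_2(y_2-z_2)^2}{x_2-\lambda}+\tfrac{d_1z_1^2+2z_1z_2+d_2z_2^2}{\lambda}: z_1\ge0,\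 z_2\ge0,\ \max\{0,x_1+x_2-1\}\le\lambda\le\min\{x_1,x_2\}\right\},$$ $$f_-^*(x,y;d)=\min_{z,\lambda}\left\{\tfrac{d_1(y_1-z_1)^2}{x_1-\lambda}+\tfrac{d_2(y_2-z_2)^2}{x_2-\lambda}+\tfrac{d_1z_1^2-2z_1z_2+d_2z_2^2}{\lambda}: z_1\le y_1,\ z_2\le y_2,\ \max\{0,x_1+x_2-1\}\le\lambda\le\min\{x_1,x_2\}\right\},$$ with $z\in\mathbb{R}^2$, values in $[0,+\infty]$, and the convention that for a nonnegative numerator $q$, $q/0=+\infty$ if $q\neq0$ and $q/0=0$ if $q=0$. The maximum over $\mathcal D$ is understood as a supremum. *)

(* Defs.v *)
From mathcomp Require Import all_boot all_order all_algebra.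
From mathcomp Require Import all_classical all_reals all_analysis.

Set Implicit Arguments.
Unset Strict Implicit.
Unset Printing Implicit Defensive.

Import Order.TTheory GRing.Theory Num.Theory.

Local Open Scope classical_set_scope.
Local Open Scope ring_scope.

Definition psdmx (R : realType) (n : nat) (A : 'M[R]_n) : Prop :=
  A^T = A /\ forall v : 'cV[R]_n, 0 <= (v^T *m A *m v) 0 0.

Definition mxinner (R : realType) (n : nat) (A B : 'M[R]_n) : R :=
  \sum_i \sum_j A i j * B i j.

Definition indicator_set (R : realType) (n : nat) : set ('cV[R]_n * 'cV[R]_n) :=
  [set p : 'cV[R]_n * 'cV[R]_n | let: (x, y) := p in
    forall i, [/\ x i 0 = 0 \/ x i 0 = 1, 0 <= y i 0
                & y i 0 * (1 - x i 0) = 0]].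

Definition qi_obj (R : realType) (n : nat) (a b : 'cV[R]_n) (Q : 'M[R]_n)
    (p : 'cV[R]_n * 'cV[R]_n) : R :=
  let: (x, y) := p in
  (a^T *m x) 0 0 + (b^T *m y) 0 0 + (y^T *m Q *m y) 0 0.

(* Rows and columns of [W] are numbered from 0: the mathematical entry W_31 is
   [W 2 0]. *)
Definition Wset (R : realType) : set (R * R * R * R * R * R * R) :=
  [set p : R * R * R * R * R * R * R |
    let: (x1, x2, y1, y2, Y11, Y12, Y22) := p in
    exists W : 'M[R]_3,
      psdmx W /\
      W 0 1 = Y12 /\
      [/\ (Y11 - W 0 0) * (x1 - W 2 2) >= (y1 - W 2 0) ^+ 2,
          W 0 0 <= Y11 & W 2 2 <= x1] /\
      [/\ (Y22 - W 1 1) * (x2 - W 2 2) >= (y2 - W 2 1) ^+ 2,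
          W 1 1 <= Y22 & W 2 2 <= x2] /\
      (0 <= W 2 0 <= y1) /\ (0 <= W 2 1 <= y2) /\
      W 2 2 >= x1 + x2 - 1].

Definition optpairs_feasible (R : realType) (n : nat) :
    set ('cV[R]_n * 'cV[R]_n * 'M[R]_n) :=
  [set p : 'cV[R]_n * 'cV[R]_n * 'M[R]_n | let: (x, y, Y) := p in
    Y^T = Y /\
    psdmx (Y - y *m y^T) /\
    (forall i j : 'I_n, (i < j)%N ->
      @Wset R (x i 0, x j 0, y i 0, y j 0, Y i i, Y i j, Y j j)) /\
    (forall i, 0 <= x i 0 <= 1) /\
    (forall i, 0 <= y i 0)].

Definition optpairs_obj (R : realType) (n : nat) (a b : 'cV[R]_n)
    (Q : 'M[R]_n) (p : 'cV[R]_n * 'cV[R]_n * 'M[R]_n) : R^o :=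
  let: (x, y, Y) := p in
  (a^T *m x) 0 0 + (b^T *m y) 0 0 + mxinner Q Y.

Definition qi_lift (R : realType) (n : nat) (p : 'cV[R]_n * 'cV[R]_n) :
    'cV[R]_n * 'cV[R]_n * 'M[R]_n :=
  let: (x, y) := p in (x, y, y *m y^T).

(* [min obj over F] is a convex program with linear objective which, through the
   embedding [e], relaxes the problem [min g over S]. *)
Definition valid_convex_relaxation (R : realType) (T : Type) (V : lmodType R)
    (S : set T) (g : T -> R) (e : T -> V) (F : set V) (obj : V -> R^o) : Prop :=
  [/\ convex_set F, linear obj &
      forall t, S t -> F (e t) /\ obj (e t) = g t].

Definition Dset (R : realType) : set (R * R) :=
  [set d | [/\ 0 <= d.1, 0 <= d.2 & 1 <= d.1 * d.2]].

(* q / t for q, t >= 0, with q / 0 = +oo if q != 0 and 0 / 0 = 0. *)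
Definition ediv (R : realType) (q t : R) : \bar R :=
  if t == 0 then (if q == 0 then 0%E else +oo%E) else (q / t)%:E.

Definition lambda_range (R : realType) (x1 x2 : R) : set R :=
  [set l | Num.max 0 (x1 + x2 - 1) <= l <= Num.min x1 x2].

(* In [fplus] and [fminus] the minimum over (z, lambda) is written as an infimum
   in [\bar R]. *)
Definition fplus (R : realType) (x1 x2 y1 y2 d1 d2 : R) : \bar R :=
  ereal_inf [set v | exists z1 z2 l : R,
    [/\ 0 <= z1, 0 <= z2, lambda_range x1 x2 l &
        v = (ediv (d1 * (y1 - z1) ^+ 2) (x1 - l)
             + ediv (d2 * (y2 - z2) ^+ 2) (x2 - l)
             + ediv (d1 * z1 ^+ 2 + 2 * z1 * z2 + d2 * z2 ^+ 2) l)%E]].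

Definition fminus (R : realType) (x1 x2 y1 y2 d1 d2 : R) : \bar R :=
  ereal_inf [set v | exists z1 z2 l : R,
    [/\ z1 <= y1, z2 <= y2, lambda_range x1 x2 l &
        v = (ediv (d1 * (y1 - z1) ^+ 2) (x1 - l)
             + ediv (d2 * (y2 - z2) ^+ 2) (x2 - l)
             + ediv (d1 * z1 ^+ 2 - 2 * z1 * z2 + d2 * z2 ^+ 2) l)%E]].

(* Main.v *)
Require Import Defs.
From mathcomp Require Import all_boot all_order all_algebra.
From mathcomp Require Import all_classical all_reals all_analysis.
From mathcomp Require Import ring lra.

Set Implicit Arguments.
Unset Strict Implicit.
Unset Printing Implicit Defensive.

Import Order.TTheory GRing.Theory Num.Theory.

Local Open Scope classical_set_scope.
Local Open Scope ring_scope.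

(** Convexity: every constraint is affine, a membership in the positive
    semidefinite cone, or a membership in the rotated second-order cone
    [u v >= w^2, u, v >= 0], except for [Y - y y' >= 0]. That one is handled by
    an identity: for [s + t = 1], the matrix [Y - y y'] of a combination is the
    combination of the two such matrices plus the rank-one term
    [s t (y - y~)(y - y~)'] ([optpairs_feasible_comb]).

    Relaxation: a point of the indicator set lifts to [Y = y y'], for which
    [Y - y y'] vanishes, and [W = x1 x2 v v'] with [v = (y1, y2, 1)] witnesses
    each pair constraint ([Wset_binary]).

    Inequalities: the entries of [W] are themselves a point at which to
    evaluate the minimum, namely [z = (W31, W32)] and [lambda = W33]. The two
    rotated cone constraints bound the first two quotients by [d1 (Y11 - W11)]
    and [d2 (Y22 - W22)]. For the third quotient, the Schur complement of [W33]
    in [W] is positive semidefinite, hence has a nonnegative inner product with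
    the matrix [[d1, e], [e, d2]] ([e = 1] or [-1]), which is positive
    semidefinite because [d1 d2 >= 1]; this bounds the quotient by
    [d1 W11 + 2 e W12 + d2 W22]. When [W33 = 0], semidefiniteness forces
    [z = 0] and the quotient is [0 / 0 = 0]. The sum of the three bounds is
    [d1 Y11 + d2 Y22 + 2 e Y12], since [W12 = Y12]
    ([pair_objective_le]). *)

(** * Closure properties of the two cones *)

Lemma psdmxD (R : realType) n (A B : 'M[R]_n) :
  psdmx A -> psdmx B -> psdmx (A + B).
Proof.
move=> [tA pA] [tB pB]; split; first by rewrite raddfD /= tA tB.
by move=> v; rewrite mulmxDr mulmxDl mxE addr_ge0.
Qed.

Lemma psdmxZ (R : realType) n (c : R) (A : 'M[R]_n) :
  0 <= c -> psdmx A -> psdmx (c *: A).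
Proof.
move=> c0 [tA pA]; split; first by rewrite linearZ /= tA.
by move=> v; rewrite -scalemxAr -scalemxAl mxE mulr_ge0.
Qed.

Lemma psdmx_mul_tr (R : realType) n (u : 'cV[R]_n) : psdmx (u *m u^T).
Proof.
split=> [|v]; first by rewrite trmx_mul trmxK.
rewrite mulmxA -mulmxA [_ *m v]mx11_scalar mul_mx_scalar mxE.
have -> : (u^T *m v) 0 0 = (v^T *m u) 0 0.
  by rewrite -[v in LHS]trmxK -trmx_mul mxE.
by rewrite -expr2 sqr_ge0.
Qed.

Lemma psdmx0 (R : realType) n : psdmx (0 : 'M[R]_n).
Proof.
by split=> [|v]; rewrite ?trmx0 // mulmx0 mul0mx mxE.
Qed.

(** The cross term is the only nontrivial one: by AM-GM,
    [2 w1 w2 <= 2 sqrt ((u1 v2) (u2 v1)) <= u1 v2 + u2 v1], which is checked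
    below by squaring. *)
Lemma rotated_cone_convex (R : realType) (s t u1 v1 w1 u2 v2 w2 : R) :
  0 <= s -> 0 <= t -> 0 <= u1 -> 0 <= v1 -> 0 <= u2 -> 0 <= v2 ->
  w1 ^+ 2 <= u1 * v1 -> w2 ^+ 2 <= u2 * v2 ->
  (s * w1 + t * w2) ^+ 2 <= (s * u1 + t * u2) * (s * v1 + t * v2).
Proof.
move=> s0 t0 u10 v10 u20 v20 h1 h2.
have cross : 2 * (w1 * w2) <= u1 * v2 + u2 * v1.
  have S0 : 0 <= u1 * v2 + u2 * v1 by rewrite addr_ge0 ?mulr_ge0.
  apply: le_trans (ler_norm _) _.
  rewrite -(ger0_norm S0) -ler_sqr ?nnegrE ?normr_ge0 //.
  rewrite !real_normK ?num_real //.
  have : w1 ^+ 2 * w2 ^+ 2 <= (u1 * v1) * (u2 * v2) by rewrite ler_pM ?sqr_ge0.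
  have := sqr_ge0 (u1 * v2 - u2 * v1); nra.
have -> : (s * u1 + t * u2) * (s * v1 + t * v2)
    = s ^+ 2 * (u1 * v1) + t ^+ 2 * (u2 * v2)
      + s * t * (u1 * v2 + u2 * v1) by ring.
have -> : (s * w1 + t * w2) ^+ 2
    = s ^+ 2 * w1 ^+ 2 + t ^+ 2 * w2 ^+ 2 + s * t * (2 * (w1 * w2)) by ring.
by rewrite !lerD ?ler_wpM2l ?sqr_ge0 ?mulr_ge0.
Qed.

(** * Convexity of the relaxation *)

Lemma Wset_convex (R : realType) (s t : R)
    (x1 x2 y1 y2 Y11 Y12 Y22 x1' x2' y1' y2' Y11' Y12' Y22' : R) :
  0 <= s -> 0 <= t -> s + t = 1 ->
  Wset (x1, x2, y1, y2, Y11, Y12, Y22) ->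
  Wset (x1', x2', y1', y2', Y11', Y12', Y22') ->
  Wset (s * x1 + t * x1', s * x2 + t * x2', s * y1 + t * y1',
        s * y2 + t * y2', s * Y11 + t * Y11', s * Y12 + t * Y12',
        s * Y22 + t * Y22').
Proof.
move=> s0 t0 st [W [pW [W12 [[a1 a2 a3] [[b1 b2 b3] [/andP[c1 c2]
  [/andP[d1 d2] e1]]]]]]] [V [pV [V12 [[a1' a2' a3'] [[b1' b2' b3']
  [/andP[c1' c2'] [/andP[d1' d2'] e1']]]]]]].
have comb (p q p' q' : R) : p <= q -> p' <= q' ->
    s * p + t * p' <= s * q + t * q'.
  by move=> *; rewrite lerD ?ler_wpM2l.
have comb0 (q q' : R) : 0 <= q -> 0 <= q' -> 0 <= s * q + t * q'.
  by move=> *; rewrite addr_ge0 ?mulr_ge0.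
have diff (p q p' q' : R) : s * p + t * p' - (s * q + t * q')
    = s * (p - q) + t * (p' - q') by ring.
exists (s *: W + t *: V); rewrite !mxE !diff.
split; first by apply: psdmxD; apply: psdmxZ.
split; first by rewrite W12 V12.
split; first by split; rewrite ?comb // rotated_cone_convex ?subr_ge0.
split; first by split; rewrite ?comb // rotated_cone_convex ?subr_ge0.
rewrite !comb ?comb0 //; split=> //; split=> //.
by have := comb _ _ _ _ e1 e1'; lra.
Qed.

Lemma optpairs_feasible_comb (R : realType) n (s t : R)
    (x y x' y' : 'cV[R]_n) (Y Y' : 'M[R]_n) :
  0 <= s -> 0 <= t -> s + t = 1 ->
  optpairs_feasible (x, y, Y) -> optpairs_feasible (x', y', Y') ->
  optpairs_feasible
    (s *: x + t *: x', s *: y + t *: y', s *: Y + t *: Y').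
Proof.
move=> s0 t0 st.
move=> [tY [pY [wY [xY yY]]]] [tY' [pY' [wY' [xY' yY']]]].
split; first by rewrite raddfD /= !linearZ /= tY tY'.
split.
  have -> : s *: Y + t *: Y' - (s *: y + t *: y') *m (s *: y + t *: y')^T
      = s *: (Y - y *m y^T) + t *: (Y' - y' *m y'^T)
        + (s * t) *: ((y - y') *m (y - y')^T).
    have -> : t = 1 - s by rewrite -st; ring.
    by apply/matrixP => i j; rewrite !mxE !big_ord1 !mxE; ring.
  by apply: psdmxD; [apply: psdmxD|]; apply: psdmxZ; rewrite ?mulr_ge0 //;
    exact: psdmx_mul_tr.
split; first by move=> i j ij; rewrite !mxE; apply: Wset_convex => //; auto.
split=> i; rewrite !mxE; last by rewrite addr_ge0 ?mulr_ge0.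
have /andP[? ?] := xY i; have /andP[? ?] := xY' i.
by rewrite addr_ge0 ?mulr_ge0 //= -st lerD // ler_piMr.
Qed.

Lemma optpairs_feasible_convex (R : realType) n :
  convex_set (@optpairs_feasible R n).
Proof.
move=> [[x y] Y] [[x' y'] Y'] l /set_mem F /set_mem F'; apply/mem_set.
apply: (optpairs_feasible_comb _ _ _ F F') => //.
  by rewrite subr_ge0.
by rewrite addrC subrK.
Qed.

Lemma optpairs_obj_linear (R : realType) n (a b : 'cV[R]_n) (Q : 'M[R]_n) :
  linear (optpairs_obj a b Q).
Proof.
move=> c [[x y] Y] [[x' y'] Y'].
change (optpairs_obj a b Q (c *: x + x', c *: y + y', c *: Y + Y')
  = c * optpairs_obj a b Q (x, y, Y) + optpairs_obj a b Q (x', y', Y')).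
have -> : optpairs_obj a b Q (c *: x + x', c *: y + y', c *: Y + Y')
   = (c * (a^T *m x) 0 0 + (a^T *m x') 0 0)
   + (c * (b^T *m y) 0 0 + (b^T *m y') 0 0)
   + (c * mxinner Q Y + mxinner Q Y').
  rewrite /optpairs_obj !mulmxDr -!scalemxAr !mxE; congr (_ + _).
  rewrite /mxinner mulr_sumr -big_split /=; apply: eq_bigr => i _.
  rewrite mulr_sumr -big_split /=; apply: eq_bigr => j _.
  by rewrite !mxE; ring.
by rewrite /optpairs_obj; ring.
Qed.

(** * Exactness on the indicator set *)

(** The factor [x1 x2] selects between the two natural witnesses: when both
    indicators are 1, [W33] is forced to be 1 and [W] is the rank-one lift;
    when one of them is 0, so is the product [y1 y2], and [W = 0] works. *)
Lemma Wset_binary (R : realType) (x1 x2 y1 y2 : R) :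
  x1 = 0 \/ x1 = 1 -> x2 = 0 \/ x2 = 1 -> 0 <= y1 -> 0 <= y2 ->
  y1 * (1 - x1) = 0 -> y2 * (1 - x2) = 0 ->
  Wset (x1, x2, y1, y2, y1 * y1, y1 * y2, y2 * y2).
Proof.
move=> x1B x2B y10 y20 c1 c2.
pose v : 'cV[R]_3 := \col_i nth 0 [:: y1; y2; 1] i.
exists ((x1 * x2) *: (v *m v^T)); split.
  apply: psdmxZ; last exact: psdmx_mul_tr.
  by case: x1B => ->; case: x2B => ->; rewrite ?mul0r ?mulr0 ?mulr1.
rewrite !mxE !big_ord1 !mxE /=.
have c1' : x1 = 0 -> y1 = 0 by move=> x10; move: c1; rewrite x10 subr0 mulr1.
have c2' : x2 = 0 -> y2 = 0 by move=> x20; move: c2; rewrite x20 subr0 mulr1.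
case: x1B c1' {c1} => -> c1'; case: x2B c2' {c2} => -> c2'.
- by rewrite c1' // c2' //; do !split; rewrite ?(mul0r, mulr0, mul1r, mulr1,
    subr0, subrr, oppr0, oppr_le0, expr0n, expr2, add0r, addr0, addrK, lexx,
    y10, y20, mulr_ge0, ler01).
- by rewrite c1' //; do !split; rewrite ?(mul0r, mulr0, mul1r, mulr1,
    subr0, subrr, oppr0, oppr_le0, expr0n, expr2, add0r, addr0, addrK, lexx,
    y10, y20, mulr_ge0, ler01).
- by rewrite c2' //; do !split; rewrite ?(mul0r, mulr0, mul1r, mulr1,
    subr0, subrr, oppr0, oppr_le0, expr0n, expr2, add0r, addr0, addrK, lexx,
    y10, y20, mulr_ge0, ler01).
- by do !split; rewrite ?(mul0r, mulr0, mul1r, mulr1,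
    subr0, subrr, oppr0, oppr_le0, expr0n, expr2, add0r, addr0, addrK, lexx,
    y10, y20, mulr_ge0, ler01).
Qed.

Lemma qi_lift_feasible (R : realType) n (p : 'cV[R]_n * 'cV[R]_n) :
  indicator_set p -> optpairs_feasible (qi_lift p).
Proof.
case: p => x y h; split; first by rewrite trmx_mul trmxK.
split; first by rewrite subrr; exact: psdmx0.
split.
  move=> i j _; rewrite !mxE !big_ord1 !mxE.
  have [? ? ?] := h i; have [? ? ?] := h j.
  exact: Wset_binary.
by split=> i; have [[]-> ? _] := h i; rewrite ?lexx ?ler01.
Qed.

Lemma qi_lift_obj (R : realType) n (a b : 'cV[R]_n) (Q : 'M[R]_n) p :
  optpairs_obj a b Q (qi_lift p) = qi_obj a b Q p.
Proof.
case: p => x y /=; congr (_ + _).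
rewrite mxE /mxinner exchange_big /=; apply: eq_bigr => j _.
rewrite mxE mulr_suml; apply: eq_bigr => i _.
by rewrite !mxE big_ord1 !mxE; ring.
Qed.

(** * The two families of inequalities *)

(** The quadratic form of [W] at [(p, q, r)], grouped by powers of [r] so that
    [discr_le] applies. *)
Lemma psdmx3_form (R : realType) (W : 'M[R]_3) (p q r : R) : psdmx W ->
  0 <= (p ^+ 2 * W 0 0 + 2 * (p * q) * W 0 1 + q ^+ 2 * W 1 1)
       + 2 * r * (p * W 2 0 + q * W 2 1) + r ^+ 2 * W 2 2.
Proof.
move=> [tW /(_ (\col_i nth 0 [:: p; q; r] i))].
rewrite !mxE !big_ord_recl !big_ord0 !mxE /= !big_ord_recl !big_ord0 !mxE /=.
have sW i j : W i j = W j i by rewrite -[in LHS]tW mxE.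
have e1 : lift ord0 ord0 = 1 :> 'I_3 by exact: val_inj.
have e2 : lift ord0 (lift ord0 ord0) = 2 :> 'I_3 by exact: val_inj.
rewrite e2 e1 (sW 1 0) (sW 0 2) (sW 1 2) => h; apply: le_trans h _.
by rewrite le_eqVlt; apply/orP; left; apply/eqP; ring.
Qed.

(** The discriminant inequality; a degenerate leading coefficient [l = 0] is
    included because [W33] may vanish. *)
Lemma discr_le (R : realType) (A m l : R) : 0 <= l ->
  (forall r, 0 <= A + 2 * r * m + r ^+ 2 * l) -> m ^+ 2 <= l * A.
Proof.
rewrite le_eqVlt => /orP[/eqP <- h|l0 h].
  have [->|m0] := eqVneq m 0; first by rewrite expr0n mul0r.
  (* At this [r] the affine function takes the value [A - (A + 1)]. *)
  have := h (- (A + 1) / (2 * m)).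
  have -> : A + 2 * (- (A + 1) / (2 * m)) * m + (- (A + 1) / (2 * m)) ^+ 2 * 0
    = -1 by field.
  by lra.
have := mulr_ge0 (ltW l0) (h (- m / l)).
have -> : l * (A + 2 * (- m / l) * m + (- m / l) ^+ 2 * l) = l * A - m ^+ 2.
  by field; rewrite gt_eqF.
by rewrite subr_ge0.
Qed.

(** The Schur complement of the last diagonal entry, evaluated at [(p, q)] and
    multiplied by that entry to stay meaningful when it is zero. *)
Lemma psdmx3_schur (R : realType) (W : 'M[R]_3) (p q : R) : psdmx W ->
  0 <= W 2 2 /\ (p * W 2 0 + q * W 2 1) ^+ 2
    <= W 2 2 * (p ^+ 2 * W 0 0 + 2 * (p * q) * W 0 1 + q ^+ 2 * W 1 1).
Proof.
move=> pW.
have l0 : 0 <= W 2 2.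
  by have := psdmx3_form 0 0 1 pW; rewrite expr0n expr1n /=; nra.
by split=> //; apply: discr_le => // r; exact: psdmx3_form.
Qed.

(** The hypothesis on [q] forces [q = 0] when [t = 0], so the infinite value of
    [ediv] does not occur. *)
Lemma ediv_le (R : realType) (q t c : R) :
  0 <= q -> 0 <= t -> 0 <= c -> q <= c * t -> (ediv q t <= c%:E)%E.
Proof.
move=> q0 t0 c0 h; rewrite /ediv; case: (eqVneq t 0) => [tE|tN].
  have -> : q = 0 by apply/eqP; rewrite eq_le q0 andbT; rewrite tE mulr0 in h.
  by rewrite eqxx lee_fin.
by rewrite lee_fin ler_pdivrMr // lt_def tN.
Qed.

(** The sign [e] treats both families at once: [e = 1] for [fplus], where
    [0 <= z] is needed, and [e = -1] for [fminus], where [z <= y] is. The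
    bound on the last quotient avoids square roots by multiplying by [d1], which
    splits the form with matrix [[d1, e], [e, d2]] into the square of
    [d1 u1 + e u2] and [(d1 d2 - 1)] times the square of [u2]. *)
Lemma pair_objective_le (R : realType)
    (x1 x2 y1 y2 Y11 Y12 Y22 : R) (d : R * R) (e : R) :
  Wset (x1, x2, y1, y2, Y11, Y12, Y22) -> Dset d -> e ^+ 2 = 1 ->
  exists z1 z2 l : R,
    [/\ 0 <= z1 <= y1, 0 <= z2 <= y2, lambda_range x1 x2 l &
      (ediv (d.1 * (y1 - z1) ^+ 2) (x1 - l)
       + ediv (d.2 * (y2 - z2) ^+ 2) (x2 - l)
       + ediv (d.1 * z1 ^+ 2 + e * (2 * z1 * z2) + d.2 * z2 ^+ 2) l
       <= (d.1 * Y11 + d.2 * Y22 + e * (2 * Y12))%:E)%E].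
Proof.
case: d => d1 d2 [W [pW [<- [[a1 a2 a3] [[b1 b2 b3] [c1 [c2 e1]]]]]]].
move=> [/= d10 d20 d12] eE.
have d1p : 0 < d1 by rewrite lt_def d10 andbT; apply: contraTneq d12 => ->;
  rewrite mul0r -ltNge ltr01.
exists (W 2 0), (W 2 1), (W 2 2).
have [l0 S] := psdmx3_schur d1 e pW.
have [_ S1] := psdmx3_schur 0 1 pW.
split=> //.
  by rewrite /lambda_range /= ge_max le_min l0 e1 a3 b3.
(* Inner product of [[d1, e], [e, d2]] with [[u, v], [v, w]], times [d1]. *)
have dE (u v w : R) : e ^+ 2 = 1 -> d1 * (d1 * u + e * (2 * v) + d2 * w)
    = (d1 ^+ 2 * u + 2 * (d1 * e) * v + e ^+ 2 * w) + (d1 * d2 - 1) * w.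
  by move=> ->; ring.
have W11 : 0 <= W 1 1.
  by have := psdmx3_form 0 1 0 pW; rewrite expr0n expr1n /=; nra.
have dd : 0 <= d1 * d2 - 1 by rewrite subr_ge0.
have z0 : 0 <= d1 * W 2 0 ^+ 2 + e * (2 * W 2 0 * W 2 1) + d2 * W 2 1 ^+ 2.
  rewrite -(pmulr_rge0 _ d1p) -mulrA dE //.
  apply: addr_ge0; last by rewrite mulr_ge0 ?sqr_ge0.
  by have := sqr_ge0 (d1 * W 2 0 + e * W 2 1); nra.
have Wq0 : 0 <= d1 * W 0 0 + e * (2 * W 0 1) + d2 * W 1 1.
  rewrite -(pmulr_rge0 _ d1p) dE //.
  apply: addr_ge0; last by rewrite mulr_ge0.
  by have := psdmx3_form d1 e 0 pW; rewrite expr0n /=; nra.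
have main : d1 * W 2 0 ^+ 2 + e * (2 * W 2 0 * W 2 1) + d2 * W 2 1 ^+ 2
    <= (d1 * W 0 0 + e * (2 * W 0 1) + d2 * W 1 1) * W 2 2.
  rewrite -(ler_pM2l d1p) [leRHS]mulrA dE // -[2 * W 2 0 * W 2 1]mulrA dE //.
  (* The sum of the Schur inequality at [(d1, e)] and of [d1 d2 - 1] times the
     one at [(0, 1)]. *)
  by nra.
have -> : d1 * Y11 + d2 * Y22 + e * (2 * W 0 1)
  = d1 * (Y11 - W 0 0) + d2 * (Y22 - W 1 1)
    + (d1 * W 0 0 + e * (2 * W 0 1) + d2 * W 1 1) by ring.
rewrite !EFinD; apply: leeD; first apply: leeD.
- apply: ediv_le; rewrite ?subr_ge0 // -?mulrA ?ler_wpM2l //.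
    by rewrite (mulr_ge0 d10) ?sqr_ge0.
  by rewrite (mulr_ge0 d10) ?subr_ge0.
- apply: ediv_le; rewrite ?subr_ge0 // -?mulrA ?ler_wpM2l //.
    by rewrite (mulr_ge0 d20) ?sqr_ge0.
  by rewrite (mulr_ge0 d20) ?subr_ge0.
- exact: ediv_le.
Qed.

Theorem proposition5 (R : realType) (n : nat) (hn : (1 <= n)%N)
    (a b : 'cV[R]_n) (Q : 'M[R]_n) (hQ : psdmx Q) :
  valid_convex_relaxation (@indicator_set R n) (qi_obj a b Q) (@qi_lift R n)
    (@optpairs_feasible R n) (optpairs_obj a b Q)
  /\
  forall (x y : 'cV[R]_n) (Y : 'M[R]_n), optpairs_feasible (x, y, Y) ->
  forall i j : 'I_n, (i < j)%N ->
    (ereal_sup ((fun d : R * R =>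
        fplus (x i 0)%R (x j 0)%R (y i 0)%R (y j 0)%R d.1 d.2
        - (d.1 * Y i i)%:E - (d.2 * Y j j)%:E - (2 * Y i j)%:E) @` @Dset R)
      <= 0)%E
    /\
    (ereal_sup ((fun d : R * R =>
        fminus (x i 0)%R (x j 0)%R (y i 0)%R (y j 0)%R d.1 d.2
        - (d.1 * Y i i)%:E - (d.2 * Y j j)%:E + (2 * Y i j)%:E) @` @Dset R)
      <= 0)%E.
Proof.
split.
  split; [exact: optpairs_feasible_convex|exact: optpairs_obj_linear|].
  by move=> p /qi_lift_feasible ?; split=> //; exact: qi_lift_obj.
move=> x y Y [_ [_ [wY _]]] i j ij; have {}wY := wY i j ij.
split; apply/ereal_supP => _ [d dD <-].
  have [z1 [z2 [l [/andP[? _] /andP[? _] lr le]]]] :=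
    pair_objective_le wY dD (expr1n _ 2).
  rewrite !leeBlDr // add0e -!EFinD; apply: ge_ereal_inf.
  eexists; first by exists z1, z2, l; split.
  move: le; rewrite !mul1r => /le_trans; apply.
  by rewrite lee_fin le_eqVlt; apply/orP; left; apply/eqP; ring.
have sqrN1 : (- 1) ^+ 2 = 1 :> R by rewrite sqrrN expr1n.
have [z1 [z2 [l [/andP[_ ?] /andP[_ ?] lr le]]]] :=
  pair_objective_le wY dD sqrN1.
rewrite -[2 * Y i j]opprK EFinN !leeBlDr // add0e -!EFinD.
apply: ge_ereal_inf.
eexists; first by exists z1, z2, l; split.
move: le; rewrite !mulN1r => /le_trans; apply.
by rewrite lee_fin le_eqVlt; apply/orP; left; apply/eqP; ring.
Qed.
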